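(* Let $I\subseteq\overline{\mathbb R}[x_1^{\pm1},\dots,x_n^{\pm1}]$ be a zero-dimensional tropical ideal. Then $$\deg(I)=\sum_{\mathbf w\in V(I)}\operatorname{mult}_{V(I)}(\mathbf w).$$
   Context: $\overline{\mathbb R}=(\mathbb R\cup\{\infty\},\min,+)$, $\mathbb B=\{0,\infty\}$. $[f]_{\mathbf x^{\mathbf u}}$ is the coefficient of $\mathbf x^{\mathbf u}$, $f(\mathbf w)=\min_{\mathbf u}([f]_{\mathbf x^{\mathbf u}}+\mathbf u\cdot\mathbf w)$. Tropical ideal (over $\overline{\mathbb R}$ or $\mathbb B$): for $f,g\in I$ and $\mathbf x^{\mathbf u}$ with $[f]_{\mathbf x^{\mathbf u}}=[g]_{\mathbf x^{\mathbf u}}\ne\infty$ there is $h\in I$ with $[h]_{\mathbf x^{\mathbf u}}=\infty$ and $[h]_{\mathbf x^{\mathbf v}}\ge\min([f]_{\mathbf x^{\mathbf v}},[g]_{\mathbf x^{\mathbf v}})$ for all $\mathbf v$, with equality when $[f]_{\mathbf x^{\mathbf v}}\ne[g]_{\mathbf x^{\mathbf v}}$. $V(I)=\{\mathbf w\in\mathbb R^n:$ for every $f\in I$, $f\ne\infty$, the minimum in $f(\mathbf w)$ is attained at least twice$\}$. Dimension/degree: for homogeneous tropical $J\subseteq K[x_0,\dots,x_n]$ ($K=\overline{\mathbb R}$ or $\mathbb B$), $H_J(e)$ is the maximum size of a set of degree-$e$ monomials containing the support of no element $\ne\infty$ of $J$; it agrees with a polynomial (the Hilbert polynomial) for $e\gg0$;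 $\dim J$ is the degree of that polynomial, and when $J$ is zero-dimensional its degree $\deg J$ is the constant value of the Hilbert polynomial. For a Laurent ideal $I$, $\dim I$ and $\deg I$ are those of the homogenization of $I\cap K[x_1,\dots,x_n]$ (the ideal generated by $\bigoplus c_{\mathbf u}x_0^{D-|\mathbf u|}\mathbf x^{\mathbf u}$, $D=\max\{|\mathbf u|:c_{\mathbf u}\ne\infty\}$, for its elements). Multiplicity: $\operatorname{in}_{\mathbf w}(f)=\bigoplus_{\mathbf u:[f]_{\mathbf x^{\mathbf u}}+\mathbf u\cdot\mathbf w=f(\mathbf w)}\mathbf x^{\mathbf u}$, $\operatorname{in}_{\mathbf w}(I)=\{\operatorname{in}_{\mathbf w}(f):f\in I\}\subseteq\mathbb B[x_1^{\pm1},\dots,x_n^{\pm1}]$ (a zero-dimensional tropical ideal), and $\operatorname{mult}_{V(I)}(\mathbf w)=\deg(\operatorname{in}_{\mathbf w}(I))$. *)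

(* Defs.v *)
(* Tropical (min,+) Laurent polynomials over Rbar = R u {oo},
   with R : realType; the coefficient oo is encoded as [None]. *)
From mathcomp Require Import all_boot all_order all_algebra.
From mathcomp Require Import reals.

Set Implicit Arguments.
Unset Strict Implicit.
Unset Printing Implicit Defensive.

Import Order.TTheory GRing.Theory Num.Theory.
Local Open Scope ring_scope.

Definition expo (k : nat) := 'rV[int]_k.

(* A tropical (Laurent) polynomial in k variables: f u = [f]_{x^u},
   [None] standing for the coefficient oo.  Finite support is required
   separately (predicate [finsupp]). *)
Definition tpoly (R : Type) (k : nat) := expo k -> option R.

Section Defs.
Variable R : realType.

Definition finsupp k (f : tpoly R k) : Prop :=
  exists s : seq (expo k), forall u, f u <> None -> u \in s.

Definition tzero k : tpoly R k := fun _ => None.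

Definition omin (a b : option R) : option R :=
  match a, b with
  | None, _ => b
  | _, None => a
  | Some x, Some y => Some (Num.min x y)
  end.

Definition ole (a b : option R) : bool :=
  match a, b with
  | _, None => true
  | None, Some _ => false
  | Some x, Some y => x <= y
  end.

Definition tadd k (f g : tpoly R k) : tpoly R k := fun u => omin (f u) (g u).

Definition tmulmon k (c : R) (v : expo k) (f : tpoly R k) : tpoly R k :=
  fun u => omap (fun a => c + a) (f (u - v)).

Definition nat_expo k (u : expo k) : Prop := forall i, (0 <= u 0 i)%R.

(* ideal of R[x_1^{+-1},...,x_k^{+-1}]: contains oo, closed under (+) and
   under multiplication by monomials (hence, by distributivity, by all
   polynomials), and consisting of finitely supported polynomials. *)
Definition laurent_ideal k (I : tpoly R k -> Prop) : Prop :=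
  [/\ I (@tzero k),
      (forall f, I f -> finsupp f),
      (forall f g, I f -> I g -> I (tadd f g)) &
      (forall c v f, I f -> I (tmulmon c v f))].

Definition elimination_axiom k (I : tpoly R k -> Prop) : Prop :=
  forall f g (u : expo k) (a : R), I f -> I g -> f u = Some a -> g u = Some a ->
  exists h, [/\ I h, h u = None &
    forall v, ole (omin (f v) (g v)) (h v) /\
              (f v <> g v -> h v = omin (f v) (g v))].

Definition tropical_ideal k (I : tpoly R k -> Prop) : Prop :=
  laurent_ideal I /\ elimination_axiom I.

Definition dotp k (u : expo k) (w : 'rV[R]_k) : R :=
  \sum_(i < k) (u 0 i)%:~R * w 0 i.

Definition attains k (f : tpoly R k) (w : 'rV[R]_k) (u : expo k) : Prop :=
  exists a, f u = Some a /\
    forall v b, f v = Some b -> a + dotp u w <= b + dotp v w.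

Definition tvariety k (I : tpoly R k -> Prop) (w : 'rV[R]_k) : Prop :=
  forall f, I f -> (exists u, f u <> None) ->
    exists u v, u != v /\ attains f w u /\ attains f w v.

(* g = in_w(f), a Boolean polynomial (coefficients in {0, oo}) *)
Definition is_initial k (w : 'rV[R]_k) (f g : tpoly R k) : Prop :=
  forall u, (g u = Some 0 <-> attains f w u) /\ (g u = Some 0 \/ g u = None).

Definition initial_ideal k (I : tpoly R k -> Prop) (w : 'rV[R]_k) : tpoly R k -> Prop :=
  fun g => exists f, I f /\ is_initial w f g.

Definition totdeg k (u : expo k) : int := \sum_(i < k) u 0 i.

Definition expo_tail k (U : expo k.+1) : expo k := \row_(i < k) U 0 (lift ord0 i).

(* F is the homogenization of f in K[x_1..x_n] (f <> oo):
   F = (+)_u c_u x_0^(D-|u|) x^u, D = max{|u| : c_u <> oo} *)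
Definition is_homogenization k (f : tpoly R k) (F : tpoly R k.+1) : Prop :=
  exists D : int,
    [/\ (exists u, f u <> None /\ totdeg u = D),
        (forall u, f u <> None -> totdeg u <= D) &
        (forall U, F U = if (0 <= U 0 ord0) && (totdeg U == D)
                         then f (expo_tail U) else None)].

(* homogenization of I \cap K[x_1,..,x_n]: the ideal of K[x_0,..,x_n]
   generated by the homogenizations of its elements (smallest set containing
   them that is closed under oo, (+), and multiplication by monomials of
   K[x_0,..,x_n]). *)
Definition homogenization k (I : tpoly R k -> Prop) : tpoly R k.+1 -> Prop :=
  fun F => forall J : tpoly R k.+1 -> Prop,
    (forall f G, I f -> (forall u, f u <> None -> nat_expo u) ->
        is_homogenization f G -> J G) ->
    J (@tzero k.+1) ->
    (forall G H, J G -> J H -> J (tadd G H)) ->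
    (forall c v G, nat_expo v -> J G -> J (tmulmon c v G)) ->
    J F.

Definition hilb_indep k (J : tpoly R k -> Prop) (e : nat) (S : seq (expo k)) : Prop :=
  [/\ uniq S,
      (forall U, U \in S -> nat_expo U /\ totdeg U = e%:Z) &
      ~ (exists F, [/\ J F, (exists U, F U <> None) &
                        forall U, F U <> None -> U \in S])].

Definition hilbert_fun k (J : tpoly R k -> Prop) (e h : nat) : Prop :=
  (exists S, hilb_indep J e S /\ size S = h) /\
  (forall S, hilb_indep J e S -> (size S <= h)%N).

Definition hilbert_poly k (J : tpoly R k -> Prop) (P : {poly rat}) : Prop :=
  exists e0 : nat, forall e : nat, (e0 <= e)%N ->
    exists h, hilbert_fun J e h /\ P.[e%:R] = h%:R.

Definition zero_dim_deg k (J : tpoly R k -> Prop) (d : nat) : Prop :=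
  exists P : {poly rat}, [/\ hilbert_poly J P, size P = 1%N & P`_0 = d%:R].

Definition laurent_zero_dim_deg k (I : tpoly R k -> Prop) (d : nat) : Prop :=
  zero_dim_deg (homogenization I) d.

End Defs.

(* Main.v *)
(* Call a finite set of monomials independent if it contains the support of no
   nonzero element of I; deg I is the maximal size d of an independent set, and
   mult(w) is the maximal size of a set X_w independent for in_w(I).  Weight
   the monomials by om(u) = - |u|^2 / (2N) with N large: the gradient of om is
   w at u = - N w, so the elements of I see the weight w near that point.  Let
   T be the union over w of the translates of X_w to - N w.
   If some g in I were supported on T, its om-minimal term would lie near some
   - N w; as om is concave, in_w(g) would then be supported on the translate of
   X_w alone, which is impossible.  Hence the sum of the mult(w) is at most d.
   Conversely, by compactness and strict concavity, every monomial u of a large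
   box outside T is the strict om-minimum, among the monomials outside T, of
   some element of I supported in the box; Gaussian elimination with these
   elements shows that no independent subset of the box is larger than T. *)
Require Import Defs.
From mathcomp Require Import all_boot all_order all_algebra.
From mathcomp Require Import all_classical reals topology normedtype.
From mathcomp Require Import zify ring lra.

Set Implicit Arguments.
Unset Strict Implicit.
Unset Printing Implicit Defensive.

Import Order.TTheory GRing.Theory Num.Theory.

(** * Finite minima, common thresholds and the Archimedean property *)

Section Preliminaries.
Local Open Scope ring_scope.

Lemma seq_min_some (R : realType) (T : eqType) (phi : T -> option R) (s : seq T) :
  (exists2 x, x \in s & phi x <> None) ->
  exists x a, [/\ x \in s, phi x = Some a &
    forall y b, y \in s -> phi y = Some b -> a <= b].
Proof.
elim: s => [[x]//|y s IHs] [x xs phix].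
have [ex|nex] := pselect (exists2 x, x \in s & phi x <> None); last first.
  have none z : z \in s -> phi z = None.
    by move=> zs; apply: contrapT => pz; apply: nex; exists z.
  move: xs phix; rewrite inE => /predU1P[->|/none->//].
  case phiy: (phi y) => [a|//] _; exists y, a; split=> //; first exact: mem_head.
  move=> z b; rewrite inE => /predU1P[->|/none->//].
  by rewrite phiy => -[->].
have [z [a [zs phiz zmin]]] := IHs ex.
have [[b [phiy ltba]]|nlt] := pselect (exists b, phi y = Some b /\ b < a).
  exists y, b; split=> //; first exact: mem_head.
  move=> t c; rewrite inE => /predU1P[->|ts]; first by rewrite phiy => -[->].
  by move=> /(zmin _ _ ts); apply: le_trans; apply: ltW.
exists z, a; split=> //; first by rewrite inE zs orbT.
move=> t c; rewrite inE => /predU1P[->|ts]; last exact: zmin.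
by move=> phiyc; rewrite leNgt; apply/negP => ltca; apply: nlt; exists c.
Qed.

(** Finitely many thresholds are merged by taking their maximum; all choices of large constants
    below go through this. *)
Lemma eventually_all (T : eqType) (Q : T -> nat -> Prop) (s : seq T) :
  (forall x, x \in s -> exists K0, forall K, (K0 <= K)%N -> Q x K) ->
  exists K0, forall K, (K0 <= K)%N -> forall x, x \in s -> Q x K.
Proof.
elim: s => [_|y s IHs Qs]; first by exists 0%N.
have [x xs|K1 QK1] := IHs; first by apply: Qs; rewrite inE xs orbT.
have [K2 QK2] := Qs y (mem_head _ _).
exists (maxn K1 K2) => K; rewrite geq_max => /andP[leK1 leK2] x.
by rewrite inE => /predU1P[->|xs]; [apply: QK2 | apply: QK1].
Qed.

Lemma archi_nat (R : realType) (x : R) : exists m : nat, x < m%:R.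
Proof.
exists (Num.bound `|x|); apply: le_lt_trans (ler_norm x) _.
exact: archi_boundP.
Qed.

End Preliminaries.

(** * Elimination and rank *)

Section Independence.
Local Open Scope ring_scope.
Variables (R : realType) (n : nat).
Implicit Types (I : tpoly R n -> Prop) (f g h : tpoly R n) (S T : seq (expo n)).

Definition nonzero f := exists u, f u <> None.

Definition supported f S := forall u, f u <> None -> u \in S.

Definition dependent I S := exists f, [/\ I f, nonzero f & supported f S].

Definition indep I S := uniq S /\ ~ dependent I S.

Definition max_indep I S :=
  indep I S /\ forall S', indep I S' -> (size S' <= size S)%N.

Lemma tmulmon_None c v f u : (tmulmon c v f u <> None) <-> (f (u - v) <> None).
Proof. by rewrite /tmulmon; case: (f _). Qed.

Lemma tadd_None f g u : (tadd f g u <> None) <-> (f u <> None \/ g u <> None).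
Proof. by rewrite /tadd; case: (f u) (g u) => [a|] [b|] /=; split=> //; first [by left | by right | by case]. Qed.

Lemma max_indep_ex I r :
  (forall S, indep I S -> (size S <= r)%N) -> exists S, max_indep I S.
Proof.
move=> le_r; pose P m := `[< exists2 S, indep I S & size S = m >].
have exP : exists m, P m.
  exists 0%N; apply/asboolP; exists [::] => //; split=> // -[f [_ [u fu] sf]].
  by have := sf u fu.
have ubP m : P m -> (m <= r)%N by move=> /asboolP[S /le_r + <-].
case: (ex_maxnP exP ubP) => m /asboolP[S indS <-] maxS.
by exists S; split=> // S' indS'; apply: maxS; apply/asboolP; exists S'.
Qed.

(** By maximality [s :: S] is dependent, and the witness must involve [s], since otherwise [S]
    itself would be dependent. *)
Lemma max_indep_mem I S s : max_indep I S -> s \notin S ->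
  exists f, [/\ I f, f s <> None & supported f (s :: S)].
Proof.
move=> [[uS indS] maxS] sS.
have [|nd] := pselect (dependent I (s :: S)); last first.
  have /maxS : indep I (s :: S) by split=> //=; rewrite sS.
  by rewrite /= ltnn.
move=> [f [If nzf sf]]; exists f; split=> // fs; apply: indS; exists f; split=> //.
by move=> u fu; have := sf u fu; rewrite inE => /predU1P[us|//]; rewrite us in fu.
Qed.

(** After adding the weight [om], the row [G s] has value 0 at [s] and positive values elsewhere on
    [A]: a tropical matrix whose diagonal entries are strict row minima. *)
Definition dominates I (om : expo n -> R) (P : expo n -> Prop)
    (A : seq (expo n)) (G : expo n -> tpoly R n) :=
  forall s, s \in A -> [/\ I (G s), (forall v, G s v <> None -> P v), 
    G s s = Some (- om s) &
    forall v b, v \in A -> v != s -> G s v = Some b -> 0 < b + om v].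

(** Tropical Gaussian elimination: each monomial of [Z] is removed at the cost of one index of [A],
    and strict dominance survives on the others. As [A] is larger than [Z], a row remains at the
    end; its diagonal entry makes it nonzero. *)
Lemma eliminate I om Z : (forall c f, I f -> I (tmulmon c 0 f)) ->
  elimination_axiom I -> forall P A G, uniq A -> (size Z < size A)%N ->
  dominates I om P A G ->
  exists h, [/\ I h, nonzero h & forall v, h v <> None -> P v /\ v \notin Z].
Proof.
move=> scal elim; elim: Z => [|z Z IHZ] P A G uA.
  case: A uA => [//|s A] uA _ /(_ s (mem_head _ _))[IGs GsP Gss _].
  exists (G s); split=> //; first by exists s; rewrite Gss.
  by move=> v /GsP.
move=> ltZA dom.
suff [A' [G' [uA' ltZA' dom']]] : exists A' G', [/\ uniq A', (size Z < size A')%N &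
    dominates I om (fun v => P v /\ v <> z) A' G'].
  have [h [Ih nzh hP]] := IHZ _ _ _ uA' ltZA' dom'.
  exists h; split=> // v /hP[[Pv /eqP vz] vZ]; split=> //.
  by rewrite inE (negPf vz).
have [ex|nex] := pselect (exists2 s, s \in A & G s z <> None); last first.
  exists (behead A), G; split; first by case: (A) uA => [|? ?] //= /andP[].
    by rewrite size_behead; move: ltZA => /=; case: (size A).
  move=> s sA; have {}sA := mem_behead sA; have [IGs GsP Gss Gsd] := dom s sA.
  split=> // [v Gsv|v b vA]; last by apply: Gsd; apply: mem_behead.
  by split; [exact: GsP | move=> vz; apply: nex; exists s; rewrite -?vz].
(* Normalizing G s s + om s to 0, the pivot s0 minimizing the z-coefficient
   is scaled by a nonnegative constant, so strict dominance is preserved. *)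
have [s0 [a0 [s0A Gs0z s0min]]] := seq_min_some ex.
have [IG0 G0P G00 G0d] := dom s0 s0A.
pose A' := rem s0 A.
have A'P s : s \in A' -> s \in A /\ s != s0.
  by rewrite /A' mem_rem_uniq // inE => /andP[].
have dom1 s : exists g, s \in A' -> [/\ I g, (forall v, g v <> None -> P v /\ v <> z),
    g s = Some (- om s) &
    forall v b, v \in A' -> v != s -> g v = Some b -> 0 < b + om v].
  have [sA'|_] := boolP (s \in A'); last by exists (G s).
  have [sA ss0] := A'P s sA'.
  have [IGs GsP Gss Gsd] := dom s sA.
  case Gsz : (G s z) => [a|]; last first.
    exists (G s) => _; split=> // [v Gsv|v b /A'P[vA _]]; last exact: Gsd.
    by split; [exact: GsP|move=> vz; rewrite vz in Gsv].
  have le_a0a := s0min s a sA Gsz.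
  pose g0 := tmulmon (a - a0) 0 (G s0).
  have g0z : g0 z = Some a by rewrite /g0 /tmulmon subr0 Gs0z /=; congr Some; ring.
  have g0d v b : v \in A' -> g0 v = Some b -> 0 < b + om v.
    move=> /A'P[vA vs0]; rewrite /g0 /tmulmon subr0.
    case G0v : (G s0 v) => [c|//] /= [<-].
    by have := G0d v c vA vs0 G0v; lra.
  have [h [Ih hz hv]] := elim _ _ z a IGs (scal (a - a0) _ IG0) Gsz g0z.
  exists h => _; split=> //.
  - move=> v hvN; split; last by move=> vz; rewrite vz hz in hvN.
    have [+ _] := hv v; case Gsv : (G s v) => [c|]; first by move=> _; apply: GsP; rewrite Gsv.
    rewrite -/g0; case g0v : (g0 v) => [c|] /=; last by case: (h v) hvN.
    move=> _; apply: G0P; have := tmulmon_None (a - a0) 0 (G s0) v.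
    by rewrite subr0 -/g0 g0v => -[+ _]; apply.
  (* The coefficient of [g0] at [s] is infinite or exceeds [- om s]. The two coefficients therefore
     differ, and elimination keeps their minimum [- om s]. *)
  - have [_ ->] := hv s; rewrite -/g0; last first.
      rewrite Gss; case g0s : (g0 s) => [c|//] [ec].
      by have := g0d s c sA' g0s; lra.
    rewrite Gss; case g0s : (g0 s) => [c|//] /=.
    by have := g0d s c sA' g0s => ?; congr Some; apply/min_idPl; lra.
  - move=> v b vA' vs hvb; have [+ _] := hv v; rewrite -/g0 hvb.
    have Gsd' c := Gsd v c (A'P v vA').1 vs; have g0d' c := g0d v c vA'.
    case: (G s v) Gsd' => [c|] Gsd'; case: (g0 v) g0d' => [c'|] g0d' //=.
    + by rewrite ge_min => /orP[]; have := Gsd' _ erefl; have := g0d' _ erefl; lra.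
    + by have := Gsd' _ erefl; lra.
    + by have := g0d' _ erefl; lra.
have [G' domG'] := choice dom1.
exists A', G'; split; first exact: rem_uniq.
  by rewrite size_rem //; move: ltZA => /=; case: (size A).
by move=> s /domG'.
Qed.

(** Let [A] be [E] minus [T] and [Z] be [E] minus [S]. If [S] were larger than [T], then [A] would
    be larger than [Z], and elimination would give a nonzero element of [I] supported on [E] off
    [Z], that is, on [S]. *)
Lemma dominated_rank I (om : expo n -> R) E T S :
  (forall c f, I f -> I (tmulmon c 0 f)) -> elimination_axiom I ->
  (forall s, s \in E -> s \notin T -> exists g a, [/\ I g, supported g E, g s = Some a &
    forall v b, v \notin T -> v != s -> g v = Some b -> a + om s < b + om v]) ->
  indep I S -> {subset S <= E} -> (size S <= size T)%N.
Proof.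
move=> scal elim dom [uS indS] SE; rewrite leqNgt; apply/negP => ltTS.
pose E' := undup E; pose A := [seq s <- E' | s \notin T].
pose Z := [seq s <- E' | s \notin S].
have uE' : uniq E' by exact: undup_uniq.
have ltZA : (size Z < size A)%N.
  have eqA := count_predC (mem T) E'; have eqZ := count_predC (mem S) E'.
  have leT : (count (mem T) E' <= size T)%N.
    rewrite -size_filter; apply: uniq_leq_size; first exact: filter_uniq.
    by move=> x; rewrite mem_filter => /andP[].
  have leS : (size S <= count (mem S) E')%N.
    rewrite -size_filter; apply: uniq_leq_size => // x xS.
    by rewrite mem_filter /= xS mem_undup SE.
  rewrite /A /Z !size_filter.
  rewrite (_ : count _ _ = count (predC (mem S)) E') //.
  rewrite (_ : count (fun s => s \notin T) _ = count (predC (mem T)) E') //.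
  lia.
have dom1 s : exists g, s \in A -> [/\ I g, (forall v, g v <> None -> v \in E),
    g s = Some (- om s) &
    forall v b, v \in A -> v != s -> g v = Some b -> 0 < b + om v].
  have [|] := boolP (s \in A); last by exists (tzero R (k:=n)).
  rewrite mem_filter mem_undup => /andP[sT sE].
  have [g [a [Ig gE gs gd]]] := dom s sE sT.
  exists (tmulmon (- om s - a) 0 g) => _; split; first exact: scal.
  - by move=> v /tmulmon_None; rewrite subr0; exact: gE.
  - by rewrite /tmulmon subr0 gs /=; congr Some; ring.
  - move=> v b; rewrite mem_filter => /andP[vT _] vs; rewrite /tmulmon subr0.
    by case gv : (g v) => [c|//] /= [<-]; have := gd v c vT vs gv; lra.
have [G domG] := choice dom1.
have [||h [Ih nzh hP]] := @eliminate I om Z scal elim (fun v => v \in E) A G _ ltZA.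
- exact: filter_uniq.
- by move=> s /domG.
apply: indS; exists h; split=> // v /hP[vE].
by rewrite mem_filter mem_undup vE andbT negbK.
Qed.

End Independence.

(** * Hilbert functions of homogenizations *)

Section Homogenization.
Local Open Scope ring_scope.
Variables (R : realType) (n : nat).
Implicit Types (I : tpoly R n -> Prop) (f g h : tpoly R n) (S T : seq (expo n)).

(** Initial ideals have only the coefficients 0 and infinity, so they need not be closed under real
    scalars. This weaker notion covers both them and [I], and it suffices because independence sees
    only supports. *)
Definition support_closed I :=
  [/\ I (@tzero R n), (forall f, I f -> finsupp f),
      (forall f g, I f -> I g -> I (tadd f g)) &
      (forall v f, I f -> I (tmulmon 0 v f))].

Lemma bounded_seq S :
  exists B, forall K, (B <= K)%N -> forall u, u \in S -> forall i, `|u 0 i| <= K%:Z.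
Proof.
apply: eventually_all => u _; exists (\max_i `|u 0%R i|)%N => K leK i.
by rewrite -abszE lez_nat (leq_trans _ leK) // (leq_bigmax (F := fun i => `|u 0%R i|%N) i).
Qed.

Lemma indep_shift I v S : support_closed I ->
  indep I S -> indep I [seq u + v | u <- S].
Proof.
move=> [_ _ _ Ishift] [uS indS]; split; first by rewrite map_inj_uniq //; exact: addIr.
move=> [f [If [u fu] sf]]; apply: indS; exists (tmulmon 0 (- v) f); split.
- exact: Ishift.
- by exists (u - v); apply/tmulmon_None; rewrite opprK subrK.
- move=> t /tmulmon_None; rewrite opprK => /sf /mapP[x xS] /eqP.
  by rewrite (inj_eq (addIr v)) => /eqP->.
Qed.

(** The exponent of total degree [e] that dehomogenizes to [u]; its entry at [x_0] is negative when
    [u] has degree above [e]. *)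
Definition hexpo (e : int) (u : expo n) : expo n.+1 :=
  \row_i (if unlift ord0 i is Some j then u 0 j else e - totdeg u).

Lemma hexpo0 e u : hexpo e u 0 ord0 = e - totdeg u.
Proof. by rewrite mxE unlift_none. Qed.

Lemma hexpoS e u i : hexpo e u 0 (lift ord0 i) = u 0 i.
Proof. by rewrite mxE liftK. Qed.

Lemma totdeg_hexpo e u : totdeg (hexpo e u) = e.
Proof.
rewrite {1}/totdeg big_ord_recl hexpo0.
by under eq_bigr do rewrite hexpoS; rewrite subrK.
Qed.

Lemma expo_tail_hexpo e u : expo_tail (hexpo e u) = u.
Proof. by apply/rowP => i; rewrite mxE hexpoS. Qed.

Lemma hexpo_tail U : hexpo (totdeg U) (expo_tail U) = U.
Proof.
apply/rowP => i; case: (unliftP ord0 i) => [j|] ->; first by rewrite hexpoS mxE.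
rewrite hexpo0 {1}/totdeg big_ord_recl /totdeg.
by under [X in _ - X]eq_bigr do rewrite mxE; rewrite addrK.
Qed.

Lemma hexpo_inj e : injective (hexpo e).
Proof. exact: can_inj (expo_tail_hexpo e). Qed.

Lemma totdegB k (u v : expo k) : totdeg (u - v) = totdeg u - totdeg v.
Proof. by rewrite /totdeg -sumrB; apply: eq_bigr => i _; rewrite !mxE. Qed.

Lemma expo_tailB (U V : expo n.+1) : expo_tail (U - V) = expo_tail U - expo_tail V.
Proof. by apply/rowP => i; rewrite !mxE. Qed.

Lemma hexpoB e u V : hexpo e u - V = hexpo (e - totdeg V) (u - expo_tail V).
Proof. by rewrite -(hexpo_tail (_ - V)) totdegB totdeg_hexpo expo_tailB expo_tail_hexpo. Qed.

Lemma nat_hexpo e u : nat_expo (hexpo e u) <-> nat_expo u /\ totdeg u <= e.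
Proof.
split=> [nat_eu|[nat_u le_ue] i].
  split=> [i|]; first by rewrite -(hexpoS e u i); exact: nat_eu.
  by rewrite -subr_ge0 -hexpo0; exact: nat_eu.
by case: (unliftP ord0 i) => [j|] ->; rewrite ?hexpoS ?hexpo0 ?subr_ge0.
Qed.

(** Induction over the generation of the homogenization, by applying its minimality to the property
    to be proved. Scalars are replaced by 0, which leaves supports unchanged. *)
Lemma homogenization_slice I F e : support_closed I -> homogenization I F ->
  exists f, I f /\ forall u, f u <> None <-> F (hexpo e u) <> None.
Proof.
move=> [I0 _ Iadd Ishift] homF; move: e.
apply: (homF (fun F => forall e, exists f, I f /\
  forall u, f u <> None <-> F (hexpo e u) <> None)).
- move=> f G If _ [D [_ leD defG]] e; have [eqe|/eqP neqe] := eqVneq e D.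
    exists f; split=> // u; rewrite defG totdeg_hexpo eqe eqxx andbT hexpo0.
    rewrite expo_tail_hexpo subr_ge0; case: ifP => // /negP nle.
    by split=> // /leD.
  exists (@tzero R n); split=> // u; rewrite defG totdeg_hexpo.
  by rewrite (introF eqP neqe) andbF.
- by move=> e; exists (@tzero R n).
- move=> G H slG slH e; have [g [Ig sg]] := slG e; have [h [Ih sh]] := slH e.
  exists (tadd g h); split; first exact: Iadd.
  by move=> u; rewrite !tadd_None sg sh.
- move=> c V G _ slG e; have [g [Ig sg]] := slG (e - totdeg V).
  exists (tmulmon 0 (expo_tail V) g); split; first exact: Ishift.
  by move=> u; rewrite !tmulmon_None sg hexpoB.
Qed.

(** Homogenize [f] in its own degree [D], then multiply by the power [e - D] of [x_0]. *)
Lemma slice_homogenization I f e : support_closed I -> I f -> nonzero f ->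
  (forall u, f u <> None -> nat_expo (hexpo e u)) ->
  exists F, homogenization I F /\
    forall U, F U <> None <-> totdeg U = e /\ f (expo_tail U) <> None.
Proof.
move=> [_ Ifin _ _] If [u0 fu0] natf; have [s sf] := Ifin f If.
(* Minimizing [- totdeg u] over the support finds a monomial of top degree. *)
have [|um [a [ums]]] := @seq_min_some R _
    (fun u => omap (fun=> - (totdeg u)%:~R) (f u)) s.
  by exists u0; [exact: sf | case: (f u0) fu0].
case fum : (f um) => [am|//] /= [<-] max_um.
pose D := totdeg um.
have leD u : f u <> None -> totdeg u <= D.
  move=> fu; have := max_um u (- (totdeg u)%:~R) (sf u fu).
  by case: (f u) fu => // b _ /(_ erefl); rewrite lerN2 ler_int.
have leDe : D <= e by have /natf/nat_hexpo[] : f um <> None by rewrite fum.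
pose G : tpoly R n.+1 := fun U =>
  if (0 <= U 0 ord0) && (totdeg U == D) then f (expo_tail U) else None.
exists (tmulmon 0 (hexpo (e - D) 0) G); split.
  move=> J hJ _ _ mJ; apply: mJ; last apply: (hJ f).
  - apply/nat_hexpo; split; first by move=> i; rewrite mxE.
    by rewrite /totdeg big1 ?subr_ge0 // => i _; rewrite mxE.
  - exact: If.
  - by move=> u /natf/nat_hexpo[].
  - by exists D; split=> //; exists um; rewrite fum.
move=> U; rewrite tmulmon_None /G totdegB expo_tailB totdeg_hexpo expo_tail_hexpo subr0.
rewrite [X in X == D](_ : _ = totdeg U - e + D); last by ring.
rewrite -subr_eq0 addrK subr_eq0.
have [eqe|neqe] := eqVneq (totdeg U) e; last by rewrite andbF; split=> // -[/eqP]; rewrite (negPf neqe).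
rewrite andbT; split; first by case: ifP => // _; split.
move=> [_ fU]; case: ifP => // /negP; case.
rewrite -(hexpo_tail U) eqe mxE hexpo0 mxE hexpo0 subr_ge0.
rewrite (_ : totdeg (0 : expo n) = 0); last by rewrite /totdeg big1 // => i _; rewrite mxE.
by have := leD _ fU; lia.
Qed.

Lemma hilb_indep_tail I (e : nat) (S' : seq (expo n.+1)) : support_closed I ->
  hilb_indep (homogenization I) e S' -> indep I [seq expo_tail U | U <- S'].
Proof.
move=> Icl [uS' degS' indS'].
have hexpoK U : U \in S' -> hexpo e (expo_tail U) = U.
  by move=> /degS'[_ <-]; exact: hexpo_tail.
split.
  rewrite map_inj_in_uniq // => U V US VS eqUV.
  by rewrite -(hexpoK U US) eqUV hexpoK.
move=> [f [If nzf sf]]; apply: indS'.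
have [u|F [homF sF]] := @slice_homogenization I f e Icl If nzf.
  by move=> /sf /mapP[U US ->]; rewrite hexpoK //; have [] := degS' U US.
exists F; split=> //.
  by have [u fu] := nzf; exists (hexpo e u); apply/sF; rewrite totdeg_hexpo expo_tail_hexpo.
move=> U /sF[eqe /sf/mapP[V VS eqUV]].
by rewrite -(hexpo_tail U) eqe eqUV hexpoK.
Qed.

Lemma hilb_indep_hexpo I (e : nat) S : support_closed I -> indep I S ->
  (forall u, u \in S -> nat_expo (hexpo e u)) ->
  hilb_indep (homogenization I) e [seq hexpo e u | u <- S].
Proof.
move=> Icl [uS indS] natS; split.
- by rewrite map_inj_uniq //; exact: hexpo_inj.
- by move=> _ /mapP[u uS' ->]; rewrite totdeg_hexpo; split=> //; exact: natS.
- move=> [F [homF [U FU] sF]]; apply: indS.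
  have [f [If sf]] := homogenization_slice e Icl homF.
  exists f; split=> //; last first.
    by move=> u /sf/sF/mapP[v vS /hexpo_inj->].
  have /mapP[v _ eU] := sF U FU.
  by exists (expo_tail U); apply/sf; rewrite {1}eU expo_tail_hexpo -eU.
Qed.

(** Monomials are units in the Laurent ring, so a finite set can be moved to nonnegative exponents;
    a large [e] then leaves room for [x_0]. *)
Lemma shift_nat S : exists (v : expo n) (e0 : nat), forall e : nat, (e0 <= e)%N ->
  forall u, u \in S -> nat_expo (hexpo e (u + v)).
Proof.
have [B leB] := bounded_seq S; pose v : expo n := \row_i B%:Z.
have [u _|e0 le0] := @eventually_all _ (fun u e => totdeg (u + v) <= e%:Z) S.
  by exists (absz (totdeg (u + v))) => K; lia.
exists v, e0 => e lee u uS; apply/nat_hexpo; split; last exact: le0.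
move=> i; rewrite !mxE; have := leB B (leqnn B) u uS i.
by rewrite ler_norml -subr_ge0 opprK => /andP[].
Qed.

(** In dimension zero the Hilbert function is eventually the constant [d]. Dehomogenizing turns
    independent sets of degree [e] into Laurent ones; shifting and homogenizing goes back. *)
Lemma laurent_deg_rank I d : support_closed I -> laurent_zero_dim_deg I d ->
  (exists S, indep I S /\ size S = d) /\ (forall S, indep I S -> (size S <= d)%N).
Proof.
move=> Icl [P [[e0 hilbP] sP P0]].
have hilb e : (e0 <= e)%N -> hilbert_fun (homogenization I) e d.
  move=> /hilbP[h [hilb_h Ph]]; suff <- : h = d by [].
  apply/eqP; rewrite -(eqr_nat rat) -Ph -P0.
  by rewrite (size1_polyC (eq_leq sP)) hornerC coefC.
split.
  have [[S' [indS' sS']] _] := hilb e0 (leqnn _).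
  exists [seq expo_tail U | U <- S']; rewrite size_map; split=> //.
  exact: hilb_indep_tail indS'.
move=> S indS; have [v [e1 nat_v]] := shift_nat S.
have [_ ub] := hilb (maxn e0 e1) (leq_maxl _ _).
rewrite -(size_map (fun u => u + v)) -(size_map (hexpo (maxn e0 e1))).
apply/ub/hilb_indep_hexpo => //; first exact: indep_shift.
by move=> _ /mapP[u uS ->]; apply: nat_v => //; exact: leq_maxr.
Qed.

(** Positivity makes the constant Hilbert polynomial nonzero, hence of [size] 1; the zero polynomial
    has [size] 0. *)
Lemma rank_laurent_deg I S : support_closed I -> max_indep I S -> (0 < size S)%N ->
  laurent_zero_dim_deg I (size S).
Proof.
move=> Icl [indS maxS] S_gt0; exists (size S)%:R%:P.
have nz : ((size S)%:R : rat) != 0 by rewrite pnatr_eq0 -lt0n.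
split; last by rewrite coefC.
  have [v [e0 nat_v]] := shift_nat S; exists e0 => e lee.
  exists (size S); rewrite hornerC; split=> //; split.
    exists [seq hexpo e u | u <- [seq u + v | u <- S]]; rewrite !size_map; split=> //.
    apply: hilb_indep_hexpo => //; first exact: indep_shift.
    by move=> _ /mapP[u uS ->]; exact: nat_v.
  by move=> S' /(hilb_indep_tail Icl)/maxS; rewrite size_map.
by rewrite size_polyC nz.
Qed.

End Homogenization.

(** * Initial ideals *)

Section InitialIdeals.
Local Open Scope ring_scope.
Variables (R : realType) (n : nat).
Implicit Types (I : tpoly R n -> Prop) (f g h : tpoly R n) (S T : seq (expo n)).
Implicit Types (u v : expo n) (w : 'rV[R]_n).

Lemma dotpD u v w : dotp (u + v) w = dotp u w + dotp v w.
Proof.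
by rewrite /dotp -big_split; apply: eq_bigr => i _; rewrite mxE intrD mulrDl.
Qed.

Lemma dotpB u v w : dotp (u - v) w = dotp u w - dotp v w.
Proof. by apply/eqP; rewrite eq_sym subr_eq -dotpD subrK. Qed.

(** A lower bound [mu] that is reached at [u0] is the value f(w), so attaining the minimum becomes
    an equation on coefficients. *)
Lemma attainsP f w mu u0 : (forall v b, f v = Some b -> mu <= b + dotp v w) ->
  f u0 = Some (mu - dotp u0 w) ->
  forall u, attains f w u <-> f u = Some (mu - dotp u w).
Proof.
move=> ge_mu fu0 u; split=> [[a [fu min_u]]|fu].
  rewrite fu; congr Some; have := ge_mu u a fu.
  by have := min_u u0 _ fu0; lra.
by exists (mu - dotp u w); split=> // v b /ge_mu; lra.
Qed.

Lemma attainsW f w u : attains f w u -> exists mu,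
  [/\ f u = Some (mu - dotp u w), (forall v b, f v = Some b -> mu <= b + dotp v w) &
      forall v, attains f w v <-> f v = Some (mu - dotp v w)].
Proof.
move=> [a [fu min_u]]; exists (a + dotp u w).
have fu' : f u = Some (a + dotp u w - dotp u w) by rewrite addrK.
by split=> //; apply: (attainsP _ fu').
Qed.

Lemma attains_some f w u : attains f w u -> f u <> None.
Proof. by move=> [a [->]]. Qed.

Lemma seq_support_min f (om : expo n -> R) : finsupp f -> nonzero f ->
  exists u a, f u = Some a /\ forall v b, f v = Some b -> a + om u <= b + om v.
Proof.
move=> [s sf] [u0 fu0].
have [|u [m [us]]] := @seq_min_some R _ (fun u => omap (fun a => a + om u) (f u)) s.
  by exists u0; [exact: sf | case: (f u0) fu0].
case fu : (f u) => [a|//] /= [<-] min_u; exists u, a; split=> // v b fv.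
by apply: (min_u v); rewrite ?fv //; apply: sf; rewrite fv.
Qed.

Lemma attains_ex f w : finsupp f -> nonzero f -> exists u, attains f w u.
Proof.
move=> fin_f nz_f; have [u [a [fu min_u]]] := seq_support_min (fun u => dotp u w) fin_f nz_f.
by exists u, a.
Qed.

Lemma attains_tmulmon c v f w u : attains (tmulmon c v f) w u <-> attains f w (u - v).
Proof.
rewrite /attains /tmulmon; split=> -[a [fu min_u]].
  case: (f (u - v)) fu => [a'|//] /= [eqa]; exists a'; split=> // t b ft.
  by have := min_u (t + v) (c + b); rewrite addrK ft dotpD dotpB => /(_ erefl); lra.
exists (c + a); rewrite fu; split=> // t b.
case ft : (f _) => [b'|//] /= [<-].
by have := min_u _ _ ft; rewrite !dotpB; lra.
Qed.

Lemma is_initial_ex f w : exists g, is_initial w f g.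
Proof.
exists (fun u => if `[< attains f w u >] then Some 0 else None) => u.
by case: asboolP => au; split=> //; [left | right].
Qed.

Lemma is_initial_some f w g u : is_initial w f g -> (g u <> None <-> attains f w u).
Proof.
move=> /(_ u)[[g0 a0] [gu|gu]]; rewrite gu; first by split=> // _; exact: g0.
by split=> [//|/a0]; rewrite gu.
Qed.

Lemma initial_support_closed I w : laurent_ideal I ->
  support_closed (initial_ideal I w).
Proof.
move=> [I0 Ifin Iadd Imul]; split.
- by exists (@tzero R n); split=> // u; split; last (by right); split=> // -[a []].
- move=> g [f [If ing]]; have [s sf] := Ifin f If.
  by exists s => u /(is_initial_some _ ing)/attains_some/sf.
- move=> g1 g2 [f1 [If1 in1]] [f2 [If2 in2]].
  have coef u : tadd g1 g2 u = Some 0 \/ tadd g1 g2 u = None.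
    have [_ h1] := in1 u; have [_ h2] := in2 u; rewrite /tadd.
    by case: h1 => ->; case: h2 => -> /=; rewrite ?minxx; [left|left|left|right].
  have sadd u : tadd g1 g2 u = Some 0 <-> attains f1 w u \/ attains f2 w u.
    rewrite -(is_initial_some u in1) -(is_initial_some u in2) -tadd_None.
    by case: (coef u) => ->.
  suff [f [If inf]] : exists f, I f /\
      forall u, attains f w u <-> attains f1 w u \/ attains f2 w u.
    by exists f; split=> // u; split=> //; rewrite sadd inf.
  have [[u1 /attainsW[mu1 [f1u1 min1 at1]]]|no1] := pselect (exists u, attains f1 w u);
    last first.
    exists f2; split=> // u; split=> [|[au|//]]; [by right | by case: no1; exists u].
  have [[u2 /attainsW[mu2 [f2u2 min2 at2]]]|no2] := pselect (exists u, attains f2 w u);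
    last first.
    exists f1; split=> // u; split=> [|[//|au]]; [by left | by case: no2; exists u].
  (* The scalar [mu1 - mu2] gives both summands the value [mu1] at [w], so the minimum of the sum is
     attained exactly on the union of the two initial supports. *)
  exists (tadd f1 (tmulmon (mu1 - mu2) 0 f2)).
  split=> [|u]; first by apply: Iadd => //; exact: Imul.
  have ge_mu v b : tadd f1 (tmulmon (mu1 - mu2) 0 f2) v = Some b -> mu1 <= b + dotp v w.
    rewrite /tadd /tmulmon subr0; have := min1 v; have := min2 v.
    case: (f1 v) (f2 v) => [a1|] [a2|] //= m2 m1 [<-].
    + have := m2 _ erefl; have := m1 _ erefl => m1' m2'.
      by rewrite /Num.min; case: ifP => _; lra.
    + exact: m1.
    + by have := m2 _ erefl; lra.
  have tval v : tadd f1 (tmulmon (mu1 - mu2) 0 f2) v = Some (mu1 - dotp v w) <->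
      attains f1 w v \/ attains f2 w v.
    rewrite at1 at2; have := ge_mu v; rewrite /tadd /tmulmon subr0; have := min1 v; have := min2 v.
    case: (f1 v) (f2 v) => [a1|] [a2|] //= m2 m1 _.
    + have := m2 _ erefl; have := m1 _ erefl => m1' m2'.
      rewrite /Num.min; case: ifP => ltb; split.
      * by move=> [<-]; left.
      * by move=> [[->]|[e2]]; congr Some; lra.
      * by move=> [e]; right; congr Some; lra.
      * by move=> [[e1]|[e2]]; congr Some; lra.
    + by split=> [|[|//]]; [left | ].
    + split=> [[e]|[//|[e]]]; [by right; congr Some; lra | by congr Some; lra].
    + by split=> // -[].
  have tu1 : tadd f1 (tmulmon (mu1 - mu2) 0 f2) u1 = Some (mu1 - dotp u1 w).
    by apply/tval; left; apply/at1.
  by rewrite (attainsP ge_mu tu1) tval.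
- move=> v g [f [If ing]]; exists (tmulmon 0 v f); split; first exact: Imul.
  move=> u; have [ing1 ing2] := ing (u - v); rewrite attains_tmulmon -ing1 /tmulmon.
  by case: ing2 => -> /=; rewrite ?addr0; split; [ | left | | right].
Qed.

(** The initial form of a nonzero element is nonzero and supported inside that element. Hence each
    multiplicity is at most the degree. *)
Lemma indep_initial I w S : laurent_ideal I ->
  indep (initial_ideal I w) S -> indep I S.
Proof.
move=> [_ Ifin _ _] [uS indS]; split=> // -[f [If nzf sf]].
have [g ing] := is_initial_ex f w; apply: indS; exists g; split.
- by exists f.
- have [u au] := attains_ex w (Ifin f If) nzf.
  by exists u; apply/(is_initial_some _ ing).
- by move=> u /(is_initial_some _ ing)/attains_some/sf.
Qed.

(** An initial form supported at 0 alone would come from an element whose minimum at [w] is attained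
    only once. So points of the variety have multiplicity at least 1. *)
Lemma tvariety_indep1 I w : laurent_ideal I ->
  tvariety I w -> indep (initial_ideal I w) [:: 0].
Proof.
move=> [_ Ifin _ _] Vw; split=> // -[g [[f [If ing]] [u0 gu0] sg]].
have sat u : attains f w u -> u = 0.
  by move=> /(is_initial_some _ ing)/sg; rewrite inE => /eqP.
have [|u [v [uv [/sat u0' /sat v0']]]] := Vw f If.
  by exists u0; apply: attains_some; apply/(is_initial_some _ ing); exact: gu0.
by rewrite u0' v0' eqxx in uv.
Qed.

(** Off the variety some initial form is a single monomial, and its translates put every monomial
    into the initial ideal. *)
Lemma ntvariety_indep I w S : laurent_ideal I ->
  ~ tvariety I w -> indep (initial_ideal I w) S -> S = [::].
Proof.
move=> [I0 Ifin Iadd Imul] nVw [uS indS]; case: S uS indS => [//|s S] _ indS.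
exfalso; apply: nVw => f If nzf; apply: contrapT => single.
have [u au] := attains_ex w (Ifin f If) nzf.
apply: indS; have [g ing] := is_initial_ex (tmulmon 0 (s - u) f) w.
exists g; split; first by exists (tmulmon 0 (s - u) f); split=> //; exact: Imul.
  exists s; apply/(is_initial_some _ ing)/attains_tmulmon.
  by rewrite opprB addrC subrK.
move=> t /(is_initial_some _ ing)/attains_tmulmon at_t.
have [eqt|net] := eqVneq (t - (s - u)) u.
  by rewrite -(subrK (s - u) t) eqt addrC subrK mem_head.
by case: single; exists (t - (s - u)), u.
Qed.

End InitialIdeals.

(** * The paraboloid weight *)

Section Paraboloid.
Local Open Scope ring_scope.
Variables (R : realType) (n : nat).
Implicit Types (f : tpoly R n) (u v : expo n) (w : 'rV[R]_n) (N : nat).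

Definition paraboloid N u : R := - (\sum_i (u 0 i)%:~R ^+ 2) / (2 * N%:R).

(* The displacement of u from - N * w, where the paraboloid has gradient w. *)
Definition offset N w u i : R := (u 0 i)%:~R + N%:R * w 0 i.

(** A lattice point approximating - N w, to which the translate of X_w is anchored. *)
Definition peak N w : expo n := \row_i Num.floor (- (N%:R * w 0 i)).

Lemma offset_peak N w i : `|offset N w (peak N w) i| <= 1.
Proof.
rewrite /offset mxE; have /andP[] := floor_itv (- (N%:R * w 0 i)).
by rewrite intrD ler_norml => *; apply/andP; split; lra.
Qed.

Lemma offsetD N w u v i : offset N w (u + v) i = offset N w u i + (v 0 i)%:~R.
Proof. by rewrite /offset mxE intrD; ring. Qed.

(** Completing the square at - N w: the paraboloid is the linear form of [w] plus a quadratic error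
    in the offsets. *)
Lemma paraboloidB N w u v : (0 < N)%N ->
  paraboloid N v - paraboloid N u = dotp v w - dotp u w +
    (\sum_i (offset N w u i ^+ 2 - offset N w v i ^+ 2)) / (2 * N%:R).
Proof.
move=> N0; have N0' : (N%:R : R) != 0 by rewrite pnatr_eq0 -lt0n.
rewrite (_ : \sum_i _ = (\sum_i (u 0 i)%:~R ^+ 2 - \sum_i (v 0 i)%:~R ^+ 2) +
    2 * N%:R * (dotp u w - dotp v w)); first by rewrite /paraboloid; field.
rewrite /dotp -!sumrB mulr_sumr -big_split /=.
by apply: eq_bigr => i _; rewrite /offset; ring.
Qed.

(** A term that is not initial exceeds the initial ones by a gap [d] independent of [K] and [N].
    Where the offsets are at most N / K, the quadratic error costs at most C / K, which is below [d]
    once [K] is large. *)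
Lemma strict_min_near f w : finsupp f -> exists K0, forall K, (K0 <= K)%N ->
  forall N, (0 < K <= N)%N -> forall t u v a b,
  attains f w u -> f u = Some a -> f v = Some b -> ~ attains f w v ->
  (forall i, K%:R * `|offset N w (u + t) i| <= N%:R) ->
  a + paraboloid N (u + t) < b + paraboloid N (v + t).
Proof.
move=> [s sf].
have [uv _|K0 HK0] := @eventually_all _ (fun uv K => forall N, (0 < K <= N)%N ->
  forall t a b, attains f w uv.1 -> f uv.1 = Some a -> f uv.2 = Some b ->
  ~ attains f w uv.2 -> (forall i, K%:R * `|offset N w (uv.1 + t) i| <= N%:R) ->
  a + paraboloid N (uv.1 + t) < b + paraboloid N (uv.2 + t))
  [seq (u, v) | u <- s, v <- s]; last first.
  exists K0 => K leK N KN t u v a b au fu fv nav; apply: (HK0 K leK (u, v)) => //.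
  by apply: allpairs_f; apply: sf; rewrite ?fu ?fv.
case: uv => u v /=.
case fu : (f u) => [a|]; last by exists 0%N.
case fv : (f v) => [b|]; last by exists 0%N.
have [[a' [fu' min_u]]|nau] := pselect (attains f w u); last by exists 0%N.
have [av|nav] := pselect (attains f w v); first by exists 0%N.
move: fu'; rewrite fu => -[ea]; subst a'.
pose d := (b + dotp v w) - (a + dotp u w).
have d_gt0 : 0 < d.
  rewrite subr_gt0 lt_neqAle min_u // andbT; apply/eqP => eqd; apply: nav.
  by exists b; split=> // t c /min_u; rewrite eqd.
pose e i : R := (v 0 i)%:~R - (u 0 i)%:~R.
pose C := \sum_i (`|e i| + e i ^+ 2).
have [K0 HK0] := archi_nat (C / d).
exists K0 => K leK N /andP[K0' KN] t _ _ _ [<-] [<-] _ near_u.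
have N0 : (0 < N)%N := leq_trans K0' KN.
have N0' : 0 < (N%:R : R) by rewrite ltr0n.
have K0r : 0 < (K%:R : R) by rewrite ltr0n.
have KNr : (K%:R : R) <= N%:R by rewrite ler_nat.
have CKd : C < K%:R * d.
  by rewrite -ltr_pdivrMr //; apply: lt_le_trans HK0 _; rewrite ler_nat.
have := paraboloidB w (u + t) (v + t) N0; rewrite !dotpD.
set S := \sum_i _ => eqS.
suff : 0 < d + S / (2 * N%:R) by rewrite /d; lra.
(* Each summand of [S] is - (2 y e + e^2) with [y] the offset at [u + t]; the bounds K |y| <= N and
   K <= N are applied termwise. *)
have KS : - (2 * N%:R * C) <= K%:R * S.
  rewrite /C /S !mulr_sumr -sumrN; apply: ler_sum => i _.
  have -> : offset N w (v + t) i = offset N w (u + t) i + e i.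
    by rewrite /e /offset !mxE !intrD; ring.
  set y := offset _ _ _ i; have := near_u i; rewrite -/y => near.
  have le1 : K%:R * (y * e i) <= N%:R * `|e i|.
    apply: le_trans (ler_norm _) _.
    rewrite normrM normrM mulrA ger0_norm ?ler0n //.
    by apply: ler_wpM2r.
  have le2 : K%:R * e i ^+ 2 <= N%:R * e i ^+ 2 by apply: ler_wpM2r; rewrite ?sqr_ge0.
  have le3 : 0 <= N%:R * e i ^+ 2 by rewrite mulr_ge0 ?sqr_ge0 ?ler0n.
  rewrite [X in _ <= X](_ : _ = - (2 * (K%:R * (y * e i)) + K%:R * e i ^+ 2)); last by ring.
  rewrite lerN2 (_ : 2 * _ * _ = 2 * (N%:R * `|e i|) + 2 * (N%:R * e i ^+ 2)); last by ring.
  by lra.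
have : 0 < K%:R * (2 * N%:R * (d + S / (2 * N%:R))).
  rewrite (_ : _ * _ = 2 * N%:R * (K%:R * d) + K%:R * S); last first.
    by field; rewrite gt_eqF.
  have : 2 * N%:R * C < 2 * N%:R * (K%:R * d) by rewrite ltr_pM2l // mulr_gt0.
  by lra.
by rewrite pmulr_rgt0 // pmulr_rgt0 // mulr_gt0.
Qed.

Lemma support_radius f : finsupp f -> exists K0, forall K, (K0 <= K)%N ->
  forall u v, f u <> None -> f v <> None -> forall i, `|v 0 i - u 0 i| <= K%:Z.
Proof.
move=> [s sf]; have [K0 HK0] := bounded_seq [seq v - u | u <- s, v <- s].
exists K0 => K leK u v fu fv i.
have := HK0 K leK (v - u) _ i; rewrite !mxE; apply.
by apply/allpairsP; exists (u, v); split=> //; exact: sf.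
Qed.

End Paraboloid.

(** * Strict dominance of monomials near a peak *)

Section Dominance.
Local Open Scope ring_scope.
Variables (R : realType) (n : nat).
Implicit Types (I : tpoly R n -> Prop) (f g : tpoly R n) (u v : expo n).
Implicit Types (w : 'rV[R]_n) (S X : seq (expo n)) (N : nat).

Lemma box_ex (B : nat) :
  exists E : seq (expo n), forall u, u \in E <-> forall i, `|u 0 i| <= B%:Z.
Proof.
exists [seq (\row_i ((h i : nat)%:Z - B%:Z)) | h : {ffun 'I_n -> 'I_(B + B).+1}] => u.
split=> [/fintype.imageP[h _ ->] i|ub].
  by rewrite mxE; case: (h i) => m /= ltm; lia.
apply/fintype.imageP; exists [ffun i => inord (absz (u 0 i + B%:Z))] => //.
apply/rowP => i; rewrite mxE ffunE; move: (u 0 i) (ub i) => x ubx.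
by rewrite inordK; lia.
Qed.

(** The [r.+1] monomials 1, x_j, ..., x_j^r are too many to be independent. *)
Lemma axis_dependent I r j : (forall S, indep I S -> (size S <= r)%N) ->
  exists f, [/\ I f, nonzero f & forall u v, f u <> None -> f v <> None ->
    (forall i, i != j -> v 0 i = u 0 i) /\ `|u 0 j - v 0 j| <= r%:Z].
Proof.
move=> le_r; pose L (k : nat) : expo n := \row_i (if i == j then k%:Z else 0).
have Lj k : L k 0 j = k%:Z by rewrite mxE eqxx.
have [|nd] := pselect (dependent I [seq L k | k <- iota 0 r.+1]); last first.
  have /le_r : indep I [seq L k | k <- iota 0 r.+1].
    split=> //; rewrite map_inj_uniq ?iota_uniq // => k k' eqL.
    by have := Lj k; rewrite eqL Lj => -[].
  by rewrite size_map size_iota ltnn.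
move=> [f [If nzf sf]]; exists f; split=> // u v /sf/mapP[k + ->] /sf/mapP[k' + ->].
rewrite !mem_iota !Lj => lek lek'; split; last by lia.
by move=> i ij; rewrite !mxE (negPf ij).
Qed.

Lemma extreme_coord g j (sg : int) : finsupp g -> nonzero g ->
  exists p, g p <> None /\ forall v, g v <> None -> sg * v 0 j <= sg * p 0 j.
Proof.
move=> [s sf] [u0 gu0].
have [|p [m [_]]] := @seq_min_some R _
    (fun u => omap (fun=> - (sg * u 0 j)%:~R) (g u)) s.
  by exists u0; [exact: sf | case: (g u0) gu0].
case gp : (g p) => [a|//] /= [<-] min_p; exists p; rewrite gp; split=> // v gv.
have := min_p v (- (sg * v 0 j)%:~R) (sf v gv).
by case: (g v) gv => // b _ /(_ erefl); rewrite lerN2 ler_int.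
Qed.

Lemma paraboloid_axis N w u v j (k : int) : (0 < N)%N ->
  (forall i, i != j -> v 0 i = u 0 i) -> v 0 j = u 0 j - k ->
  paraboloid R N v - paraboloid R N u = dotp v w - dotp u w +
    k%:~R * (2 * offset N w u j - k%:~R) / (2 * N%:R).
Proof.
move=> N0 off vj; rewrite (paraboloidB w u v N0) (bigD1 j) //= big1 ?addr0.
  congr (_ + _); congr (_ / _); rewrite /offset vj intrB; ring.
by move=> i ij; rewrite /offset off // subrr.
Qed.

Lemma sign_ex (x : R) : exists sg : int, (sg = 1 \/ sg = -1) /\ sg%:~R * x = `|x|.
Proof.
have [x0|x0] := ger0P x.
  by exists 1; split; [left | rewrite mul1r].
by exists (-1); split; [right | rewrite rmorphN1 mulN1r].
Qed.

(** This is the sign of the quadratic term in [paraboloid_axis]: a step [x] towards the peak,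
    shorter than the offset [y], strictly raises that term. *)
Lemma sign_gt0 (sg : int) (x y : R) : sg = 1 \/ sg = -1 ->
  0 < sg%:~R * x -> sg%:~R * x < sg%:~R * y -> 0 < x * (2 * y - x).
Proof.
case=> -> x0 xy; first by apply: mulr_gt0; lra.
by rewrite -mulrNN; apply: mulr_gt0; lra.
Qed.

(** [K] is past the thresholds of both [strict_min_near] and [support_radius]. *)
Definition tame f w K :=
  (forall N, (0 < K <= N)%N -> forall t u v a b,
    attains f w u -> f u = Some a -> f v = Some b -> ~ attains f w v ->
    (forall i, K%:R * `|offset N w (u + t) i| <= N%:R) ->
    a + paraboloid R N (u + t) < b + paraboloid R N (v + t)) /\
  (forall u v, f u <> None -> f v <> None -> forall i, `|v 0 i - u 0 i| <= K%:Z).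

Lemma tame_ex f w : finsupp f -> exists K0, forall K, (K0 <= K)%N -> tame f w K.
Proof.
move=> fin_f; have [K1 HK1] := strict_min_near w fin_f.
have [K2 HK2] := support_radius fin_f.
exists (maxn K1 K2) => K; rewrite geq_max => /andP[le1 le2].
by split; [exact: HK1 | exact: HK2].
Qed.

(* Away from the peak, the initial forms along a coordinate axis have
   their strict minimum at the outermost point, by strict concavity; near the
   peak, finitely many initial forms express everything in terms of X. *)
Lemma local_dominance I w X : tropical_ideal I -> max_indep (initial_ideal I w) X ->
  exists K, (0 < K)%N /\ forall N, (K <= N)%N -> forall u,
    (forall i, K%:R * `|offset N w u i| <= N%:R) -> u - peak N w \notin X ->
    exists g a, [/\ I g, g u = Some a,
      forall v, g v <> None -> forall i, `|v 0 i - u 0 i| <= K%:Z &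
      forall v b, v - peak N w \notin X -> v != u -> g v = Some b ->
        a + paraboloid R N u < b + paraboloid R N v].
Proof.
move=> [Ilaur elim] maxX; have [I0 Ifin Iadd Imul] := Ilaur.
set r := size X.
have axis j : exists f, [/\ I f, exists u, attains f w u &
    forall u v, attains f w u -> attains f w v ->
    (forall i, i != j -> v 0 i = u 0 i) /\ `|u 0 j - v 0 j| <= r%:Z].
  have [g [[f [If ing]] [u0 gu0] gj]] := axis_dependent j maxX.2.
  exists f; split=> // [|u v au av]; first by exists u0; apply/(is_initial_some _ ing).
  by apply: gj; apply/(is_initial_some _ ing).
have [F HF] := choice axis.
have block s : exists f, s \notin X -> [/\ I f, attains f w s &
    forall v, attains f w v -> v \in s :: X].
  have [sX|sX] := boolP (s \in X); first by exists (@tzero R n).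
  have [g [[f [If ing]] gs sg]] := max_indep_mem maxX sX.
  exists f => _; split=> //; first exact/(is_initial_some _ ing).
  by move=> v /(is_initial_some _ ing)/sg.
have [G HG] := choice block.
have [B HB] := box_ex r.+1.
have [j _|K1 HK1] := @eventually_all _ (fun j => tame (F j) w) (enum 'I_n).
  by apply: tame_ex; have [/Ifin] := HF j.
have [s _|K2 HK2] := @eventually_all _ (fun s K => s \notin X -> tame (G s) w K) B.
  have [sX|sX] := boolP (s \in X); first by exists 0%N.
  have [/Ifin/(tame_ex w)[K2 HK2] _ _] := HG s sX.
  by exists K2 => K /HK2.
pose K := (maxn K1 K2).+1.
have leK1 : (K1 <= K)%N by rewrite leqW // leq_maxl.
have leK2 : (K2 <= K)%N by rewrite leqW // leq_maxr.
exists K; split=> // N KN u near_u uX.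
have KN' : (0 < K <= N)%N by [].
have N0 : (0 < N)%N by exact: leq_trans KN.
have N0r : 0 < (N%:R : R) by rewrite ltr0n.
have [[j far]|/forallNP near] := pselect (exists j, r%:R < `|offset N w u j|).
  have [IFj [u0 au0] axisj] := HF j.
  have [smin rad] := HK1 K leK1 j (mem_enum _ _).
  (* With [sg] the sign of the offset, [p] below is the initial monomial lying outermost in the
     direction away from the peak. Translating [p] to [u] puts the other initial terms on the peak
     side. *)
  have [sg [sg2 sgy]] := sign_ex (offset N w u j).
  have [g0 ing0] := is_initial_ex (F j) w.
  have [s sF] := Ifin _ IFj.
  have [||p [g0p maxp]] := @extreme_coord g0 j sg.
  - by exists s => t /(is_initial_some _ ing0)/attains_some/sF.
  - by exists u0; apply/(is_initial_some _ ing0).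
  have ap : attains (F j) w p by apply/(is_initial_some _ ing0).
  have [a [Fp min_p]] := ap.
  exists (tmulmon 0 (u - p) (F j)), a; split; first exact: Imul.
  - by rewrite /tmulmon opprB addrC subrK Fp /= add0r.
  - move=> v /tmulmon_None Fv i; rewrite -(subrK (u - p) v) !mxE.
    have := rad p (v - (u - p)) (attains_some ap) Fv i; rewrite !mxE.
    by congr (`|_| <= _); ring.
  move=> v b _ vu; rewrite /tmulmon; set v' := v - (u - p).
  have eqv : v = v' + (u - p) by rewrite subrK.
  have equ : u = p + (u - p) by rewrite addrC subrK.
  case Fv : (F j v') => [b'|//] /= [<-]; rewrite add0r.
  (* Terms that are not initial lose by the gap. Among initial terms the linear parts agree, so the
     concave quadratic part decides. *)
  have [av|nav] := pselect (attains (F j) w v'); last first.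
    by rewrite eqv {1}equ; apply: smin => //; rewrite -equ.
  have [offj radj] := axisj p v' ap av.
  have cv i : v 0 i = v' 0 i + (u 0 i - p 0 i) by rewrite !mxE; ring.
  have offj' i : i != j -> v 0 i = u 0 i.
    by move=> ij; rewrite cv offj //; ring.
  pose k := p 0 j - v' 0 j.
  have vj : v 0 j = u 0 j - k by rewrite /k cv; ring.
  have := paraboloid_axis w N0 offj' vj.
  have sgk : 0 <= sg * k.
    by rewrite /k mulrBr subr_ge0; apply: maxp; apply/(is_initial_some _ ing0).
  have k0 : k != 0.
    apply: contraNneq vu => k0; apply/eqP/rowP => i.
    by have [->|ij] := eqVneq i j; [rewrite vj k0 subr0 | exact: offj'].
  have sg0 : sg != 0 by case: sg2 => ->.
  have sgk0 : 0 < sg * k by rewrite lt_neqAle eq_sym mulf_neq0 ?sg0.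
  have sgkr : sg * k <= r%:Z.
    apply: le_trans (ler_norm _) _; rewrite normrM.
    by case: sg2 => ->; rewrite ?normrN normr1 mul1r.
  have pos : 0 < k%:~R * (2 * offset N w u j - k%:~R).
    apply: (sign_gt0 sg2); first by rewrite -intrM ltr0z.
    by rewrite sgy -intrM; apply: le_lt_trans far; rewrite -(ler_int R) in sgkr.
  have pos' : 0 < k%:~R * (2 * offset N w u j - k%:~R) / (2 * N%:R).
    by rewrite divr_gt0 // mulr_gt0.
  have [c [Fv' min_v]] := av.
  have eqc : c = b' by move: Fv'; rewrite Fv => -[].
  have := min_v _ _ Fp; have := min_p _ _ Fv.
  have : dotp v w = dotp v' w + (dotp u w - dotp p w) by rewrite {1}eqv dotpD dotpB.
  by rewrite eqc; lra.
pose s := u - peak N w.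
(* The offset of [u] is at most [r] and that of the peak at most 1, whence the radius [r.+1] of the
   box. *)
have sB : s \in B.
  apply/HB => i; rewrite -(ler_int R) intr_norm.
  have -> : ((s 0 i)%:~R : R) = offset N w u i - offset N w (peak N w) i.
    by rewrite /s /offset !mxE !intrD; ring.
  apply: le_trans (ler_normB _ _) _.
  have := near i; have := offset_peak N w i => le1 /negP; rewrite -leNgt => le2.
  by rewrite -addn1 PoszD intrD; apply: lerD.
have [IGs [a [Gs min_s]] Gsup] := HG s uX.
have [smin rad] := HK2 K leK2 s sB uX.
exists (tmulmon 0 (peak N w) (G s)), a; split; first exact: Imul.
- by rewrite /tmulmon -/s Gs /= add0r.
- move=> v /tmulmon_None Gv i.
  have := rad s (v - peak N w) _ Gv i; rewrite Gs /s !mxE.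
  by move=> /(_ (fun e => ltac:(discriminate e))); congr (`|_| <= _); ring.
move=> v b vX vu; rewrite /tmulmon; case Gv : (G s _) => [b'|//] /= [<-].
rewrite add0r; set v' := v - _ in Gv vX.
have eqv : v = v' + peak N w by rewrite subrK.
have equ : u = s + peak N w by rewrite subrK.
rewrite eqv {1}equ; apply: smin => //; [by exists a| |by rewrite -equ].
move=> /Gsup; rewrite inE => /orP[/eqP ev|]; last by rewrite (negPf vX).
by rewrite eqv equ ev eqxx in vu.
Qed.

End Dominance.

(** * Finite covers of a box by balls of varying radius *)

Section Cover.
Local Open Scope ring_scope.
Local Open Scope classical_set_scope.
Import numFieldNormedType.Exports.

(** The constant of [local_dominance] depends on [w] with no uniform bound at hand; compactness of
    the box leaves finitely many [w] to consider. *)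
Lemma finite_box_cover (R : realType) (n : nat) (L : R) (r : 'rV[R]_n -> R) :
  (forall w, 0 < r w) ->
  exists s : seq 'rV[R]_n, uniq s /\ forall x : 'rV[R]_n,
    (forall i, `|x 0 i| <= L) -> exists2 w, w \in s & forall i, `|x 0 i - w 0 i| <= r w.
Proof.
move=> r_gt0; pose A := [set x : 'rV[R]_n | forall i, `[- L, L] (x ord0 i)].
have cA : compact A by apply: (@rV_compact R n (fun=> `[- L, L])) => i; exact: segment_compact.
move: cA; rewrite compact_cover.
move=> /(_ _ setT (fun w => (ball w (r w))^°)) [].
- by move=> w _; exact: open_interior.
- by move=> x _; exists x => //; apply: nbhsx_ballx.
move=> D _ Dcov; exists (finmap.enum_fset D); split; first exact: finmap.fset_uniq.
move=> x xL; have /Dcov[w wD xw] : A x.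
  by move=> i; rewrite /= in_itv /= -ler_norml; have := xL i.
exists w => // i; have := interior_subset xw.
move=> -[_ /(_ 0 i)]; rewrite /= distrC => /ltW; exact.
Qed.

End Cover.

(** * Comparison of ranks *)

Section Rank.
Local Open Scope ring_scope.
Variables (R : realType) (n : nat).
Implicit Types (I : tpoly R n -> Prop) (f g : tpoly R n) (u v : expo n).
Implicit Types (w : 'rV[R]_n) (S : seq (expo n)) (X : 'rV[R]_n -> seq (expo n)).
Implicit Types (N : nat) (s : seq 'rV[R]_n).

(** Far out along axis [j], an element of [I] on a line parallel to that axis is translated so that
    its outermost monomial is [u]. The concavity gain beats all differences of its coefficients, and
    its other monomials lie closer to the origin, so no box is left. *)
Lemma boundary_dominance I r : tropical_ideal I ->
  (forall S, indep I S -> (size S <= r)%N) ->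
  exists L K, forall N, (0 < N)%N -> (K <= N)%N -> forall u j,
    (L * N)%N%:Z <= `|u 0 j| ->
    exists g a, [/\ I g, g u = Some a,
      forall v, g v <> None -> forall i, `|v 0 i| <= `|u 0 i| &
      forall v b, v != u -> g v = Some b -> a + paraboloid R N u < b + paraboloid R N v].
Proof.
move=> [[I0 Ifin Iadd Imul] elim] le_r.
have [F HF] := choice (fun j => axis_dependent j le_r).
have [j _|L HL] := @eventually_all _ (fun j L => forall u v a b,
    F j u = Some a -> F j v = Some b -> 2 * (a - b) < L%:R) (enum 'I_n).
  have [/Ifin[s sF] _ _] := HF j.
  have [uv _|L HL] := @eventually_all _ (fun uv L => forall a b,
      F j uv.1 = Some a -> F j uv.2 = Some b -> 2 * (a - b) < L%:R)
      [seq (u, v) | u <- s, v <- s].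
    case: uv => u v /=; case: (F j u) => [a|]; last by exists 0%N.
    case: (F j v) => [b|]; last by exists 0%N.
    have [L HL] := archi_nat (2 * (a - b)); exists L => K leK _ _ [<-] [<-].
    by apply: lt_le_trans HL _; rewrite ler_nat.
  exists L => K leK u v a b Fu Fv; apply: (HL K leK (u, v)) => //.
  by apply: allpairs_f; apply: sF; rewrite ?Fu ?Fv.
(* For a step of length k between 1 and [r] <= N, the bound |u_j| >= (L + 1) N gives a gain of at
   least L / 2, more than any coefficient difference. It also keeps the step from crossing 0. *)
exists L.+1, r => N N0 leN u j far.
have N0r : 0 < (N%:R : R) by rewrite ltr0n.
have [IFj nzF axisj] := HF j.
have [sg [sg2 sgu]] := sign_ex (offset N (0 : 'rV[R]_n) u j).
have sguj : sg * u 0 j = `|u 0 j|.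
  apply/eqP; rewrite -(eqr_int R) intrM intr_norm.
  by move: sgu; rewrite /offset mxE mulr0 addr0 => ->.
have [p [Fp maxp]] := extreme_coord j sg (Ifin _ IFj) nzF.
case Fpa : (F j p) (Fp) => [a|//] _.
have supp v : F j (v - (u - p)) <> None ->
    [/\ forall i, i != j -> v 0 i = u 0 i, v != u -> 0 < sg * (u 0 j - v 0 j) &
        sg * (u 0 j - v 0 j) <= r%:Z].
  set v' := v - (u - p) => Fv.
  have cv i : v 0 i = v' 0 i + (u 0 i - p 0 i) by rewrite !mxE; ring.
  have [offj radj] := axisj p v' Fp Fv.
  have offj' i : i != j -> v 0 i = u 0 i by move=> ij; rewrite cv offj //; ring.
  have ek : u 0 j - v 0 j = p 0 j - v' 0 j by rewrite cv; ring.
  rewrite ek; split=> //; last first.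
    apply: le_trans (ler_norm _) _; rewrite normrM.
    by case: sg2 => ->; rewrite ?normrN normr1 mul1r.
  move=> vu; have : 0 <= sg * (p 0 j - v' 0 j) by rewrite mulrBr subr_ge0 maxp.
  rewrite le_eqVlt => /predU1P[/esym/eqP|//].
  rewrite mulf_eq0 (_ : (sg == 0) = false) /=; last by case: sg2 => ->.
  rewrite -ek subr_eq0 => /eqP uv; case/eqP: vu; apply/rowP => i.
  by have [->|/offj'] := eqVneq i j.
exists (tmulmon 0 (u - p) (F j)), a; split; first exact: Imul.
- by rewrite /tmulmon opprB addrC subrK Fpa /= add0r.
- move=> v /tmulmon_None/supp[offj posj radj] i.
  have [->|/offj->//] := eqVneq i j.
  have [->//|/posj] := eqVneq v u.
  move: far sguj radj; case: sg2 => ->; move: (u 0 j) (v 0 j) => x y.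
    by rewrite !mul1r; nia.
  by rewrite !mulN1r; nia.
move=> v b vu; rewrite /tmulmon.
case Fv : (F j _) => [b'|//] /= [<-]; rewrite add0r.
have [|offj /(_ vu) posj radj] := supp v; first by rewrite Fv.
have := paraboloid_axis (0 : 'rV[R]_n) N0 offj (esym (subKr _ _)).
rewrite [dotp v _]big1 => [|i _]; last by rewrite mxE mulr0.
rewrite [dotp u _]big1 => [|i _]; last by rewrite mxE mulr0.
rewrite subrr add0r; set k := u 0 j - v 0 j in posj radj |- *.
have off : offset N (0 : 'rV[R]_n) u j = (u 0 j)%:~R by rewrite /offset mxE mulr0 addr0.
rewrite off in sgu |- *.
have ab := HL L (leqnn L) j (mem_enum _ _) p (v - (u - p)) a b' Fpa Fv.
move=> eqS; clearbody k.
suff : (L%:R : R) <= k%:~R * (2 * (u 0 j)%:~R - k%:~R) / N%:R.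
  by rewrite invfM mulrCA [2^-1 * _]mulrC in eqS => leL; lra.
rewrite ler_pdivlMr // -natrM.
suff leZ : (L * N)%N%:Z <= k * (2 * u 0 j - k).
  by move: leZ; rewrite -(ler_int R) (intrM _ k) intrB (intrM _ _ (u 0 j)).
clear eqS; move: far sguj posj radj; case: sg2 => ->; move: (u 0 j) k => x k.
  by rewrite !mul1r; nia.
by rewrite !mulN1r; nia.
Qed.

(** For large [N] every monomial of a box outside the union [T] of translates is dominated, so
    [dominated_rank] applies. The list [s] may contain points off the variety. *)
Lemma rank_le_sum I r X S : tropical_ideal I ->
  (forall S', indep I S' -> (size S' <= r)%N) ->
  (forall w, max_indep (initial_ideal I w) (X w)) -> indep I S ->
  exists s, uniq s /\ (size S <= \sum_(w <- s) size (X w))%N.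
Proof.
move=> tropI le_r maxX indS; have [[I0 Ifin Iadd Imul] elim] := tropI.
have [K HK] := choice (fun w => local_dominance tropI (maxX w)).
have [L [K1 HL]] := boundary_dominance tropI le_r.
have K0 w : 0 < ((K w)%:R : R) by rewrite ltr0n; have [] := HK w.
have [|s [us cover_s]] := finite_box_cover L%:R (r := fun w => (K w)%:R^-1).
  by move=> w; rewrite invr_gt0.
exists s; split=> //.
have [B HB] := bounded_seq S.
pose N := maxn (maxn K1 B.+1) (\max_(w <- s) K w).
have leK1 : (K1 <= N)%N by rewrite !leq_max leqnn.
have leB : (B < N)%N by rewrite !leq_max leqnn orbT.
have leK w : w \in s -> (K w <= N)%N.
  by move=> ws; rewrite leq_max; apply/orP; right; exact: leq_bigmax_seq.
have N0 : (0 < N)%N by exact: leq_ltn_trans leB.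
have N0r : 0 < (N%:R : R) by rewrite ltr0n.
(* The layer between L N and (L + 1) N absorbs the supports from [local_dominance], which reach at
   most K w <= N beyond the inner box. *)
have [E HE] := box_ex n (L.+1 * N).
pose T := [seq x + peak N w | w <- s, x <- X w].
have -> : (\sum_(w <- s) size (X w) = size T)%N.
  by rewrite size_allpairs_dep sumnE big_map.
apply: (@dominated_rank R n I (paraboloid R N) E T S) => //.
- by move=> c f; exact: Imul.
- move=> u uE uT; move/HE: (uE) => leE.
  have [[j far]|/forallNP near] := pselect (exists j, (L * N)%N%:Z <= `|u 0 j|).
    have [g [a [Ig gu gE gmin]]] := HL N N0 leK1 u j far.
    exists g, a; split=> // [v gv|v b _]; last exact: gmin.
    by apply/HE => i; exact: le_trans (gE v gv i) (leE i).
  have {}near i : `|u 0 i| <= (L * N)%N%:Z.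
    by apply: ltW; rewrite ltNge; apply/negP/near.
  (* The paraboloid has gradient - u / N at [u]; being within 1 / K w of [w] says exactly that the
     offset of [u] is at most N / K w. *)
  have [|w ws uw] := cover_s (\row_i (- (u 0 i)%:~R / N%:R)).
    move=> i; rewrite mxE normrM normrN normfV (ger0_norm (ltW N0r)).
    by rewrite ler_pdivrMr // -intr_norm -natrM; have := near i; rewrite -(ler_int R).
  have [_ HKw] := HK w.
  have [|||g [a [Ig gu gE gmin]]] := HKw N _ u.
  + exact: leK.
  + move=> i; have := uw i; rewrite mxE.
    rewrite -(ler_pM2l N0r) -{1}(ger0_norm (ltW N0r)) -normrM.
    rewrite ler_pdivlMr ?K0 // mulrC; congr (_ * _ <= _).
    rewrite -normrN; congr (`|_|); rewrite /offset; field.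
    by rewrite gt_eqF.
  + apply: contra uT => uX; apply/allpairsPdep.
    by exists w, (u - peak N w); rewrite subrK.
  exists g, a; split=> // [v gv|v b vT]; last first.
    apply: gmin; apply: contra vT => vX; apply/allpairsPdep.
    by exists w, (v - peak N w); rewrite subrK.
  apply/HE => i; rewrite -(subrK (u 0 i) (v 0 i)).
  apply: le_trans (ler_normD _ _) _; rewrite mulSn PoszD lerD //.
  by apply: le_trans (gE v gv i) _; rewrite lez_nat leK.
- move=> u uS; apply/HE => i; apply: le_trans (HB B (leqnn B) u uS i) _.
  by rewrite lez_nat mulSn (leq_trans (ltnW leB)) // leq_addr.
Qed.

(** For large [N] the translates of the sets [X w] are disjoint and their union is independent for
    [I], so its size is at most [r]. *)
Lemma sum_initial_le I r X s : tropical_ideal I ->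
  (forall S, indep I S -> (size S <= r)%N) -> uniq s ->
  (forall w, w \in s -> indep (initial_ideal I w) (X w)) ->
  (\sum_(w <- s) size (X w) <= r)%N.
Proof.
move=> [[I0 Ifin Iadd Imul] elim] le_r us indX.
have [w _|C HC] := @eventually_all _ (fun w C =>
    forall x, x \in X w -> forall i, `|x 0 i| <= C%:Z) s; first exact: bounded_seq.
(* [M] bounds the offsets on a translate: [C] from [X w] and 1 from rounding the peak. [D] is the
   separation of centres that rules out a monomial within n M of one and within M of another. *)
pose M : R := C.+1%:R; pose D : R := n%:R * M + M.
have M0 : 1 <= M by rewrite ler1n.
have near w N x i : w \in s -> x \in X w -> `|offset N w (x + peak N w) i| <= M.
  move=> ws xX; rewrite addrC offsetD; apply: le_trans (ler_normD _ _) _.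
  rewrite /M -natr1 [X in _ <= X]addrC; apply: lerD; first exact: offset_peak.
  by have := HC C (leqnn C) w ws x xX i; rewrite -(ler_int R) intr_norm.
have [ww _|N0 HN0] := @eventually_all _ (fun (ww : 'rV[R]_n * 'rV[R]_n) N => ww.1 <> ww.2 ->
    exists i, D < N%:R * `|ww.1 0 i - ww.2 0 i|) [seq (w, w') | w <- s, w' <- s].
  case: ww => w w' /=; have [->|/eqP ww'] := eqVneq w w'; first by exists 0%N.
  have [i wi] : exists i, w 0 i <> w' 0 i.
    by apply: contrapT => /forallNP eqw; apply: ww'; apply/rowP => i; apply: contrapT.
  have d0 : 0 < `|w 0 i - w' 0 i| by rewrite normr_gt0 subr_eq0; apply/eqP.
  have [N0 HN0] := archi_nat (D / `|w 0 i - w' 0 i|).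
  exists N0 => N leN _; exists i; rewrite -ltr_pdivrMr //.
  by apply: lt_le_trans HN0 _; rewrite ler_nat.
pose N := N0.+1.
have N0r : 0 < (N%:R : R) by rewrite ltr0n.
have far w w' u : w \in s -> w' \in s ->
    (forall i, `|offset N w u i| <= n%:R * M \/ `|offset N w u i| <= M) ->
    (forall i, `|offset N w' u i| <= M) -> w = w'.
  move=> ws w's nw nw'; apply: contrapT => ww'.
  have [i Di] := HN0 N (leqnSn _) (w, w') (allpairs_f _ ws w's) ww'.
  have n1 : 1 <= (n%:R : R) by rewrite ler1n (leq_ltn_trans _ (ltn_ord i)).
  have le_nM : M <= n%:R * M by rewrite ler_peMl // (le_trans ler01).
  suff : N%:R * `|w 0 i - w' 0 i| <= D by rewrite leNgt Di.
  rewrite -{1}(ger0_norm (ltW N0r)) -normrM.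
  rewrite (_ : _ * _ = offset N w u i - offset N w' u i); last by rewrite /offset; ring.
  apply: le_trans (ler_normB _ _) _; apply: lerD; last exact: nw'.
  by have [//|/le_trans] := nw i; apply.
pose T := [seq x + peak N w | w <- s, x <- X w].
have -> : (\sum_(w <- s) size (X w) = size T)%N.
  by rewrite size_allpairs_dep sumnE big_map.
apply: le_r; split.
  apply: allpairs_uniq_dep => // [w /indX[]//|].
  move=> _ _ /allpairsPdep[w [x [ws xX ->]]] /allpairsPdep[w' [x' [ws' xX' ->]]] /= eqx.
  have eqw : w = w'.
    apply: (far w w' (x + peak N w)) => // i; first by right; exact: near.
    by rewrite eqx; exact: near.
  by subst w'; rewrite (addIr _ eqx).
move=> [g [Ig nzg gT]].
have [u [a [gu min_u]]] := seq_support_min (paraboloid R N) (Ifin g Ig) nzg.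
have /allpairsPdep[w [x [ws xX equ]]] : u \in T by apply: gT; rewrite gu.
have [g' ing'] := is_initial_ex (tmulmon 0 (- peak N w) g) w.
have [_] := indX w ws; apply; exists g'; split.
- by exists (tmulmon 0 (- peak N w) g); split=> //; exact: Imul.
- have [t at_t] := attains_ex w (Ifin g Ig) nzg.
  exists (t - peak N w); apply/(is_initial_some _ ing')/attains_tmulmon.
  by rewrite opprK subrK.
move=> t /(is_initial_some _ ing')/attains_tmulmon; rewrite opprK.
set v := t + peak N w => -[b [gv min_v]].
have /allpairsPdep[w' [x' [ws' xX' eqv]]] : v \in T by apply: gT; rewrite gv.
suff eqw : w = w' by subst w'; rewrite (addIr _ eqv).
apply: (far w w' v) => // i; last by rewrite eqv; exact: near.
left; have := paraboloidB w u v (ltn0Sn N0 : (0 < N)%N); have := min_v _ _ gu; have := min_u _ _ gv.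
(* Since [u] is minimal for the paraboloid weight and [v] for the linear weight [w], the offset of
   [v] is no longer than that of [u] in Euclidean norm. So its entries are at most sqrt(n) M <= n
   M. *)
set Q := \sum_i _ => le1 le2 eqQ.
have Q0 : 0 <= Q.
  have : 0 <= Q / (2 * N%:R) by lra.
  by rewrite pmulr_lge0 // invr_gt0 mulr_gt0.
have sq_le : \sum_i offset N w v i ^+ 2 <= n%:R * M ^+ 2.
  have : \sum_i offset N w v i ^+ 2 <= \sum_i offset N w u i ^+ 2.
    by rewrite -subr_ge0 -sumrB.
  move/le_trans; apply.
  rewrite mulr_natl -[X in _ *+ X](card_ord n) -sumr_const; apply: ler_sum => j _.
  rewrite -real_normK ?num_real //; apply: lerXn2r; rewrite ?nnegrE //.
  by rewrite equ; exact: near.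
have n1 : 1 <= (n%:R : R) by rewrite ler1n (leq_ltn_trans _ (ltn_ord i)).
rewrite -(ler_pXn2r (_ : 0 < 2)%N) ?nnegrE ?mulr_ge0 ?(le_trans ler01 M0) //.
rewrite real_normK ?num_real //.
apply: le_trans (_ : n%:R * M ^+ 2 <= _); last first.
  by rewrite exprMn ler_wpM2r ?sqr_ge0 // expr2 ler_peMl // (le_trans ler01).
apply: le_trans sq_le; rewrite (bigD1 i) //= lerDl.
by apply: sumr_ge0 => j _; rewrite sqr_ge0.
Qed.

End Rank.

(** * The degree as the sum of the multiplicities *)

Theorem theorem5p10 (R : realType) (n : nat) (I : tpoly R n -> Prop) (d : nat) :
  tropical_ideal I -> laurent_zero_dim_deg I d ->
  exists (s : seq 'rV[R]_n) (m : 'rV[R]_n -> nat),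
    [/\ uniq s,
        (forall w, tvariety I w <-> w \in s),
        (forall w, w \in s -> laurent_zero_dim_deg (initial_ideal I w) (m w)) &
        d = (\sum_(w <- s) m w)%N].
Proof.
move=> tropI degI; have [Ilaur elim] := tropI.
have Icl : support_closed I.
  by have [I0 Ifin Iadd Imul] := Ilaur; split=> // v f; exact: Imul.
have [[S [indS sS]] le_d] := laurent_deg_rank Icl degI.
have ex_max w : exists X, max_indep (initial_ideal I w) X.
  by apply: (@max_indep_ex _ _ _ d) => S' /(indep_initial Ilaur)/le_d.
have [X maxX] := choice ex_max.
(* Each point of the variety contributes at least 1 to a sum bounded by [d], so finite subsets of it
   have at most [d] points; a largest one is the whole variety. *)
pose P k := `[< exists2 s : seq 'rV[R]_n, uniq s /\ (forall w, w \in s -> tvariety I w) &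
                  size s = k >].
have exP : exists k, P k by exists 0%N; apply/asboolP; exists [::].
have leP k : P k -> (k <= d)%N.
  move=> /asboolP[s [us Vs] <-].
  have := @sum_initial_le R n I d (fun=> [:: 0%R]) s tropI le_d us
    (fun w ws => tvariety_indep1 Ilaur (Vs w ws)).
  by rewrite /= sum1_size.
case: (ex_maxnP exP leP) => k /asboolP[s [us Vs] <-] max_s.
have memV w : tvariety I w <-> w \in s.
  split=> [Vw|/Vs//]; apply: contraT => ws.
  have /max_s : P (size (w :: s)).
    apply/asboolP; exists (w :: s) => //=; rewrite ws us; split=> // w'.
    by rewrite inE => /predU1P[->|/Vs].
  by rewrite /= ltnn.
exists s, (fun w => size (X w)); split=> // [w /Vs Vw|].
  apply: rank_laurent_deg => //; first exact: initial_support_closed.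
  by have [_ /(_ _ (tvariety_indep1 Ilaur Vw))] := maxX w.
apply/eqP; rewrite eqn_leq; apply/andP; split; last first.
  by apply: (sum_initial_le tropI le_d us) => w _; have [] := maxX w.
have [s' [us' leS]] := rank_le_sum tropI le_d maxX indS.
rewrite -sS (leq_trans leS) //.
(* Points of the cover off the variety contribute 0, and the remaining ones form a subset of [s]. *)
rewrite (bigID (mem s)) /= [X in (_ + X)%N]big1 ?addn0; last first.
  move=> w ws; have [indX _] := maxX w.
  by rewrite (ntvariety_indep Ilaur _ indX) // => /memV; rewrite (negPf ws).
rewrite -big_filter.
apply: (uniq_sub_le_big leqnn (fun x y => leq_addr y x)) => //; first exact: filter_uniq.
by move=> w; rewrite mem_filter => /andP[].
Qed.
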